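(* Let $\mathbb{F}$ be an algebraically closed field of characteristic $0$, let $p(x,y)=\sum_{0\le i,j\le K}a_{ij}x^iy^j\in\mathbb{F}[x,y]$, let $X\in\mathbb{F}^{M\times M}$, $Y\in\mathbb{F}^{N\times N}$, and let $P(X,Y)=\sum_{0\le i,j\le K}a_{ij}(X^i\otimes Y^j)\in\mathbb{F}^{MN\times MN}$. For each Jordan block of $X$ (of size $m$ with eigenvalue $\lambda$) and for each Jordan block of $Y$ (of size $n$ with eigenvalue $\mu$), put $p_x:=\hat\partial_x p(\lambda,\mu)$, $p_y:=\hat\partial_y p(\lambda,\mu)$ and assume that $(p_x,p_y)\neq(0,0)$. Then the Jordan canonical form of $P(X,Y)$ is obtained by collecting, over all such pairs of Jordan blocks (counted with multiplicity), the following Jordan blocks with eigenvalue $p(\lambda,\mu)$: (1) If $p_x\neq0\neq p_y$: $\min(m,n)$ Jordan blocks, of sizes $m+n+1-2\min(m,n),\ m+n+3-2\min(m,n),\ \dots,\ m+n-1$. (2) If $p_y=0$ but either $m=1$ or $p_x\neq0$: let $r$ be the minimal $1\le k\le n-1$ such that $\hat\partial_{y^k}p(\lambda,\mu)\neq0$ (or $r=n$ if all these are zero), and let $a,b$ be the unique integers with $n=ar+b$, $0\le b<r$. Then there are $(r-b)\min(m,a)+b\min(m,a+1)$ Jordan blocks, namely: $r-b$ copies of Jordan blocks of sizes $m+a+1-2\min(m,a),\ m+a+3-2\min(m,a),\ \dots,\ m+a-1$, and $b$ copies of Jordan blocks of sizes $m+a+2-2\min(m,a+1),\ m+a+4-2\min(m,a+1),\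 \dots,\ m+a$. (3) If $p_x=0$ but either $n=1$ or $p_y\neq0$: let $r$ be the minimal $1\le k\le m-1$ such that $\hat\partial_{x^k}p(\lambda,\mu)\neq0$ (or $r=m$ if all these are zero), and let $a,b$ be the unique integers with $m=ar+b$, $0\le b<r$. Then there are $(r-b)\min(n,a)+b\min(n,a+1)$ Jordan blocks, namely: $r-b$ copies of Jordan blocks of sizes $n+a+1-2\min(n,a),\ n+a+3-2\min(n,a),\ \dots,\ n+a-1$, and $b$ copies of Jordan blocks of sizes $n+a+2-2\min(n,a+1),\ n+a+4-2\min(n,a+1),\ \dots,\ n+a$.
   Context: $\otimes$ is the Kronecker product; $X^0$, $Y^0$ are identity matrices. A Jordan block of size $m$ with eigenvalue $\lambda$ is $J_m(\lambda)=\lambda I_m+N_m$, where $N_m$ is the nilpotent matrix with ones on the first superdiagonal and zeros elsewhere. The Hasse derivatives $\hat\partial_{x^\alpha}=\frac{1}{\alpha!}\frac{\partial^\alpha}{\partial x^\alpha}$ and $\hat\partial_{y^\beta}=\frac1{\beta!}\frac{\partial^\beta}{\partial y^\beta}$ are the $\mathbb{F}$-linear operators on $\mathbb{F}[x,y]$ with $\hat\partial_{x^\alpha}\hat\partial_{y^\beta}x^iy^j=\binom{i}{\alpha}\binom{j}{\beta}x^{i-\alpha}y^{j-\beta}$ if $\alpha\le i$ and $\beta\le j$, and $0$ otherwise; $\hat\partial_x=\hat\partial_{x^1}$, $\hat\partial_y=\hat\partial_{y^1}$. Lists of sizes ''$s,\ s+2,\ \dots,\ t$'' increase in steps of $2$;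 the phrase ''$c$ copies of Jordan blocks of sizes $s,s+2,\dots,t$'' means $c$ blocks of each size in the list. When $a\ge1$ the list $m+a+1-2\min(m,a),\dots,m+a-1$ has $\min(m,a)$ entries (and similarly for the others). *)

(* Defs.v *)
From mathcomp Require Import all_boot all_order all_algebra.
From mathcomp Require Import polyXY mxred.
From mathcomp Require Export mxtens.

Set Implicit Arguments.
Unset Strict Implicit.
Unset Printing Implicit Defensive.

Import GRing.Theory.
Local Open Scope ring_scope.

Section JordanForms.
Variable F : fieldType.

Definition jordan_block (m : nat) (lam : F) : 'M[F]_m :=
  lam%:M + \matrix_(i < m, j < m) (i.+1 == j :> nat)%:R.

(* A Jordan matrix is given by the list of its blocks (size, eigenvalue),
   repeated according to multiplicity. *)
Definition jordan_dim (s : seq (nat * F)) : nat :=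
  \sum_(i < size s) (nth (0%N, 0%R) s i).1.

Definition jordan_mx (s : seq (nat * F)) : 'M[F]_(jordan_dim s) :=
  \mxdiag_(i < size s)
    jordan_block (nth (0%N, 0%R) s i).1 (nth (0%N, 0%R) s i).2.

(* The order of the blocks in s is irrelevant: block permutations are
   similarities. *)
Definition jordan_form (n : nat) (A : 'M[F]_n) (s : seq (nat * F)) : Prop :=
  all (fun u => 0 < u.1)%N s /\
  exists e : jordan_dim s = n,
    similar_in unitmx A (castmx (e, e) (jordan_mx s)).

End JordanForms.

Section BivariatePolynomials.
Variable F : fieldType.

(* x is the outer variable 'X and y is the inner variable 'Y = 'X%:P;
   accordingly p.[lam, mu] is p evaluated at x = lam, y = mu. *)
Definition bipoly (K : nat) (a : nat -> nat -> F) : {poly {poly F}} :=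
  \sum_(i < K.+1) \sum_(j < K.+1) (a i j)%:P%:P * ('X ^+ i * 'Y ^+ j).

Definition kron_eval (K M N : nat) (a : nat -> nat -> F)
    (X : 'M[F]_M) (Y : 'M[F]_N) : 'M[F]_(M * N) :=
  \sum_(i < K.+1) \sum_(j < K.+1) a i j *: (X ^+ i *t Y ^+ j).

Definition hasse (al be : nat) (p : {poly {poly F}}) : {poly {poly F}} :=
  map_poly (nderivn be) (p^`N(al)).

(* The binomials vanish unless al <= i and be <= j. *)
Lemma hasseXY (al be i j : nat) :
  hasse al be ('X ^+ i * 'Y ^+ j) =
  ('X ^+ (i - al) * 'Y ^+ (j - be)) *+ ('C(i, al) * 'C(j, be)).
Proof.
have -> : 'X ^+ i * 'Y ^+ j = 'X^j *: 'X^i :> {poly {poly F}}.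
  by rewrite mulrC -rmorphXn /= mul_polyC.
have -> : 'X ^+ (i - al) * 'Y ^+ (j - be) = 'X^(j - be) *: 'X^(i - al)
          :> {poly {poly F}}.
  by rewrite mulrC -rmorphXn /= mul_polyC.
rewrite /hasse nderivnZ nderivnXn -scalerMnr raddfMn /= mulnC mulrnA.
congr (_ *+ _); apply/polyP=> k.
rewrite coef_map_id0 ?linear0 // coefMn !coefZ !coefXn.
by case: eqP => _; rewrite ?mulr1 ?mulr0 ?linear0 ?mul0rn ?nderivnXn.
Qed.

End BivariatePolynomials.

(* s, s + 2, ..., t; empty when t < s. *)
Definition steps2 (s t : nat) : seq nat :=
  [seq (s + 2 * i)%N | i <- iota 0 (t.+2 - s)./2].

(* The minimal 1 <= k <= n - 1 with f k != 0, or n if there is none. *)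
Definition first_nonzero (F : fieldType) (f : nat -> F) (n : nat) : nat :=
  head n [seq k <- iota 1 n.-1 | f k != 0].

Definition sizes_both (m n : nat) : seq nat :=
  steps2 (m + n + 1 - 2 * minn m n) (m + n - 1).

Definition sizes_one (m n r : nat) : seq nat :=
  let a := (n %/ r)%N in let b := (n %% r)%N in
  flatten (nseq (r - b) (steps2 (m + a + 1 - 2 * minn m a) (m + a - 1))) ++
  flatten (nseq b (steps2 (m + a + 2 - 2 * minn m a.+1) (m + a))).

Definition count_one (m n r : nat) : nat :=
  let a := (n %/ r)%N in let b := (n %% r)%N in
  ((r - b) * minn m a + b * minn m a.+1)%N.

Section PairsOfBlocks.
Variables (F : fieldType) (p : {poly {poly F}}) (u v : nat * F).
(* u = (m, lam) is a block of X and v = (n, mu) is a block of Y. *)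
Let m := u.1.
Let n := v.1.
Let dxy (al be : nat) : F := (hasse al be p).[u.2, v.2].

Definition px : F := dxy 1 0.
Definition py : F := dxy 0 1.

(* When (px, py) != (0, 0), exactly one of the three cases holds. *)
Definition case_both : bool := (px != 0) && (py != 0).
Definition case_x : bool := (py == 0) && ((m == 1%N) || (px != 0)).
Definition case_y : bool := (px == 0) && ((n == 1%N) || (py != 0)).

Definition order_y : nat := first_nonzero (fun k => dxy 0 k) n.
Definition order_x : nat := first_nonzero (fun k => dxy k 0) m.

Definition pair_sizes : seq nat :=
  if case_both then sizes_both m n
  else if case_x then sizes_one m n order_y
  else if case_y then sizes_one n m order_x
  else [::].

Definition pair_count : nat :=
  if case_both then minn m n
  else if case_x then count_one m n order_y
  else if case_y then count_one n m order_x
  else 0%N.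

Definition pair_blocks : seq (nat * F) :=
  [seq (k, p.[u.2, v.2]) | k <- pair_sizes].

End PairsOfBlocks.

Definition all_blocks (F : fieldType) (p : {poly {poly F}})
    (sX sY : seq (nat * F)) : seq (nat * F) :=
  flatten [seq pair_blocks p u v | u <- sX, v <- sY].

(* Main.v *)
Require Import Defs.
From mathcomp Require Import all_boot all_order all_algebra.
From mathcomp Require Import polyXY.
From HB Require Import structures.
From mathcomp Require Import mxred ring zify.

(** The Jordan form of an operator A is read off from vectors w with
    w (A - c)^k = 0 whose chains w, w (A - c), ..., w (A - c)^(k-1) together
    form a basis ([chain_system_jordan_form]).  Since the proposed sizes sum to
    MN ([pair_blocks_dim]), it is enough that the chains span; this can be
    checked for each pair of blocks separately.

    If g and h generate a chain of X (size m, eigenvalue lam) and of Y (size n,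
    eigenvalue mu), then w = g (x) h generates under X (x) 1 and 1 (x) Y a
    cyclic module over F[x, y] on which x = X - lam and y = Y - mu satisfy
    x^m = y^n = 0, and P(X, Y) acts on it as p.  Expanding p at (lam, mu) when
    p_x is nonzero gives p - p(lam, mu) = x u + y^r v with u(lam, mu) = p_x,
    where r is the order of vanishing in y, and v is nonzero at (lam, mu)
    unless r >= n ([local_expansion]).  When p_y is nonzero too, r = 1, so that
    the first case of the theorem is the instance r = 1 of the second; the third
    case follows by exchanging x and y.

    Put x' = x u and y' = y^r v.  Writing n = a r + b, the cyclic module is
    spanned by r layers w y^i F[x', y'] with i < r, on which x' and y' have
    nilpotency indices m and a + 1 (for i < b) or a (for b <= i): up to terms of
    higher degree in x and y, the vector w y^i x'^k y'^l is a nonzero multiple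
    of w x^k y^(i + r l) ([cyclic_chains]).

    What remains is the classical decomposition of x' + y' on
    F[x', y']/(x'^m, y'^l) in characteristic 0 ([clebsch_gordan_chains]).
    Seen dually, x' + y' is the derivation D = d/ds + d/dt on the polynomials
    in s, t of degrees < m and < l.  As D(s - t) = 0, multiplication by s - t
    commutes with D and embeds the space for (m - 1, l - 1) into that for
    (m, l); restricting to s = t shows that this image and the chain of length
    m + l - 1 generated by the top monomial span everything.  Induction then
    produces the sizes m + l - 1, m + l - 3, ... *)

Import GRing.Theory.
Local Open Scope ring_scope.

Set Implicit Arguments.
Unset Strict Implicit.
Unset Printing Implicit Defensive.

(** * Families of Jordan chains *)

Section JordanChains.
Variable F : fieldType.

Definition chain_vec (n : nat) (A : 'M[F]_n) (z : nat * F * 'rV[F]_n) (j : nat)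
  : 'rV[F]_n := z.2 *m (A - z.1.2%:M) ^+ j.

Definition chain_span n (A : 'M[F]_n) (l : seq (nat * F * 'rV[F]_n))
  : 'M[F]_n :=
  (\sum_(z <- l) \sum_(j < z.1.1) <<chain_vec A z j>>)%MS.

(** The chains may be linearly dependent; a dimension count excludes this in
    [chain_system_jordan_form]. *)
Definition chain_system n (A : 'M[F]_n) (s : seq (nat * F)) (S : 'M[F]_n) :=
  exists l : seq (nat * F * 'rV[F]_n),
    [/\ [seq z.1 | z <- l] = s,
        {in l, forall z, chain_vec A z z.1.1 = 0}
      & S = chain_span A l].

Section Systems.
Variables (n : nat) (A : 'M[F]_n).
Implicit Types (s t : seq (nat * F)) (S V : 'M[F]_n).

Lemma chain_vecS z j :
  chain_vec A z j.+1 = chain_vec A z j *m (A - z.1.2%:M).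
Proof. by rewrite /chain_vec exprSr -mulmxE mulmxA. Qed.

Lemma chain_vec_span l z j :
  z \in l -> (j < z.1.1)%N -> (chain_vec A z j <= chain_span A l)%MS.
Proof.
move=> lz ltj; rewrite /chain_span (big_rem z lz) /=.
apply: submx_trans (addsmxSl _ _).
by apply: (sumsmx_sup (Ordinal ltj)); rewrite ?genmxE.
Qed.

Lemma chain_span_sub m l (V : 'M[F]_(m, n)) :
  {in l, forall z j, (j < z.1.1)%N -> (chain_vec A z j <= V)%MS} ->
  (chain_span A l <= V)%MS.
Proof.
rewrite /chain_span; elim: l => [|z l IH] sub; first by rewrite big_nil sub0mx.
rewrite big_cons addsmx_sub IH ?andbT; last first.
  by move=> y ly; apply: sub; rewrite inE ly orbT.
by apply/sumsmx_subP=> j _; rewrite genmxE sub ?mem_head.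
Qed.

Lemma chain_system_nil : chain_system A [::] 0.
Proof. by exists [::]; split=> //; rewrite /chain_span big_nil. Qed.

Lemma chain_system_cat s t S V :
  chain_system A s S -> chain_system A t V ->
  chain_system A (s ++ t) (S + V)%MS.
Proof.
move=> [l1 [<- ann1 ->]] [l2 [<- ann2 ->]]; exists (l1 ++ l2); split.
- by rewrite map_cat.
- by move=> z; rewrite mem_cat => /orP[/ann1|/ann2].
- by rewrite /chain_span big_cat.
Qed.

Lemma chain_system1 k c (w : 'rV[F]_n) :
  w *m (A - c%:M) ^+ k = 0 ->
  chain_system A [:: (k, c)] (\sum_(j < k) <<w *m (A - c%:M) ^+ j>>)%MS.
Proof.
move=> ann; exists [:: (k, c, w)]; split=> //.
- by move=> z; rewrite inE => /eqP->.
- by rewrite /chain_span big_seq1.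
Qed.

(** A maps each vector of a chain to a combination of itself and its
    successor; the last successor is zero. *)
Lemma chain_system_stable s S c :
  chain_system A s S -> (S *m (A - c%:M) <= S)%MS.
Proof.
move=> [l [_ ann ->]].
have stabA: (chain_span A l *m A <= chain_span A l)%MS.
  rewrite submxE -mulmxA; apply/eqP/sub_kermxP.
  apply: chain_span_sub => z lz j ltj.
  apply/sub_kermxP; rewrite mulmxA; apply/eqP; rewrite -submxE.
  have -> : chain_vec A z j *m A =
            chain_vec A z j.+1 + z.1.2 *: chain_vec A z j.
    by rewrite chain_vecS mulmxBr mul_mx_scalar subrK.
  apply: addmx_sub; last by rewrite scalemx_sub ?chain_vec_span.
  case: (ltngtP j.+1 z.1.1) => [lt|gt|eq]; first exact: chain_vec_span.
    by rewrite ltnNge ltj in gt.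
  by rewrite eq ann ?sub0mx.
by rewrite mulmxBr mul_mx_scalar addmx_sub ?eqmx_opp ?scalemx_sub.
Qed.

(** Chain systems found independently, each covering the vectors of one
    predicate, concatenate in the order of the index list.  This order matters
    since [jordan_form] is stated for a list of blocks. *)
Lemma chain_system_flatten (I : eqType) (r : seq I) (s : I -> seq (nat * F))
    (P : I -> 'rV[F]_n -> Prop) :
  {in r, forall i, exists2 S, chain_system A (s i) S &
     forall v, P i v -> (v <= S)%MS} ->
  exists2 S, chain_system A (flatten [seq s i | i <- r]) S &
     {in r, forall i v, P i v -> (v <= S)%MS}.
Proof.
elim: r => [|i r IH] cov; first by exists 0 => //; apply: chain_system_nil.
have [S1 sys1 sub1] := cov i (mem_head _ _).
have [j rj|S2 sys2 sub2] := IH; first by apply: cov; rewrite inE rj orbT.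
exists (S1 + S2)%MS; first exact: chain_system_cat.
move=> j; rewrite inE => /predU1P[-> v /sub1 vS | /sub2 sub v /sub vS].
  exact: submx_trans vS (addsmxSl _ _).
exact: submx_trans vS (addsmxSr _ _).
Qed.

End Systems.

Lemma jordan_block_row m c n (q : nat -> 'rV[F]_n) (i : 'I_m) :
  row i (jordan_block m c *m \matrix_(j < m) q j) =
  c *: q i + (if (i.+1 < m)%N then q i.+1 else 0).
Proof.
rewrite mulmxDl mul_scalar_mx linearD linearZ /= rowK; congr (_ + _).
rewrite row_mul mulmx_sum_row; case: ltnP => [lt|le].
  rewrite (bigD1 (Ordinal lt)) //= rowK !mxE eqxx scale1r.
  rewrite big1 ?addr0 // => j ne; rewrite !mxE.
  by case: eqP => [eq|]; rewrite ?scale0r //; rewrite -val_eqE /= eq eqxx in ne.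
apply: big1 => j _; rewrite !mxE; case: eqP => [eq|]; rewrite ?scale0r //.
by have := ltn_ord j; rewrite -eq ltnNge le.
Qed.

(** Chains are exactly the rows of the matrices intertwining A with a Jordan
    block; this direction turns a chain into such a matrix. *)
Lemma jordan_block_chain m c n (A : 'M[F]_n) (w : 'rV[F]_n) :
  w *m (A - c%:M) ^+ m = 0 ->
  let Q := \matrix_(j < m) (w *m (A - c%:M) ^+ j) in
  Q *m A = jordan_block m c *m Q.
Proof.
move=> ann Q; apply/row_matrixP=> i; rewrite row_mul rowK.
rewrite (jordan_block_row c (fun k => w *m (A - c%:M) ^+ k)).
have step (v : 'rV[F]_n) : v *m A = c *: v + v *m (A - c%:M).
  by rewrite mulmxBr mul_mx_scalar addrC subrK.
rewrite step -mulmxA mulmxE -exprSr.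
congr (_ + _); case: ltnP => // le.
by have -> : i.+1 = m by apply/eqP; rewrite eqn_leq le ltn_ord.
Qed.

Lemma jordan_block_chainV m c n (A : 'M[F]_n) (Q : 'M[F]_(m, n))
    (w : 'rV[F]_n) :
  (forall i : 'I_m, val i = 0%N -> row i Q = w) -> (0 < m)%N ->
  Q *m A = jordan_block m c *m Q ->
  w *m (A - c%:M) ^+ m = 0 /\ forall i : 'I_m, row i Q = w *m (A - c%:M) ^+ i.
Proof.
case: m Q => // m Q w0 _ QA.
pose q k : 'rV[F]_n := if (k < m.+1)%N then row (inord k) Q else 0.
have Qq : Q = \matrix_(i < m.+1) q i.
  by apply/row_matrixP=> i; rewrite rowK /q ltn_ord inord_val.
have step (i : 'I_m.+1) : q i *m (A - c%:M) = q i.+1.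
  have := congr1 (row i) QA; rewrite Qq jordan_block_row row_mul rowK mulmxBr.
  by rewrite mul_mx_scalar => ->; rewrite addrC addKr /q; case: (i.+1 < m.+1)%N.
have q0 : q 0%N = w by rewrite /q /= w0 // /= inordK.
have pow k : (k <= m.+1)%N -> w *m (A - c%:M) ^+ k = q k.
  elim: k => [|k IH] le; first by rewrite mulmx1 q0.
  by rewrite exprSr -mulmxE mulmxA IH ?(ltnW le) // (step (Ordinal le)).
split=> [|i]; first by rewrite pow // /q ltnn.
by rewrite pow ?(ltnW (ltn_ord i)) // /q ltn_ord inord_val.
Qed.

(** Stacking the chains gives a square matrix intertwining A with the Jordan
    matrix; it is square by the dimension hypothesis, hence invertible as soon
    as the chains span. *)
Lemma chain_system_jordan_form n (A : 'M[F]_n) s (S : 'M[F]_n) :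
  all (fun u => 0 < u.1)%N s -> jordan_dim s = n ->
  chain_system A s S -> row_full S -> jordan_form A s.
Proof.
move=> pos dims [l [ls ann ->]] full; split=> //; exists dims.
case: _ / dims A l ls ann full => A l ls ann full; rewrite castmx_id.
have sizel : size l = size s by have /(congr1 size) := ls; rewrite size_map.
pose z i := nth (0%N, 0, 0) l i.
have zs i : (i < size s)%N -> nth (0%N, 0) s i = (z i).1.
  move=> lti; have /(congr1 (fun t => nth (0%N, 0) t i)) := ls.
  by rewrite (nth_map (0%N, 0, 0)) ?sizel.
pose B (i : 'I_(size s)) : 'M[F]_((nth (0%N, 0) s i).1, _) :=
  \matrix_(j < (nth (0%N, 0) s i).1)
     ((z i).2 *m (A - (nth (0%N, 0) s i).2%:M) ^+ j).
have fullB : row_full (\mxcol_i B i).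
  rewrite -sub1mx; move: full; rewrite -sub1mx => /submx_trans-> //.
  rewrite eqmx_col; apply: chain_span_sub => y ly j ltj.
  have lti : (index y l < size s)%N by rewrite -sizel index_mem.
  have zy : z (index y l) = y by rewrite /z nth_index.
  have ltj' : (j < (nth (0%N, 0%R) s (Ordinal lti)).1)%N by rewrite zs //= zy.
  apply: (sumsmx_sup (Ordinal lti)) => //; rewrite genmxE.
  have <- : row (Ordinal ltj') (B (Ordinal lti)) = chain_vec A y j.
    by rewrite rowK /= zs // zy.
  exact: row_sub.
have unitB : (\mxcol_i B i : 'M[F]_(jordan_dim s)) \in unitmx.
  by rewrite -row_full_unit.
exists (\mxcol_i B i : 'M[F]_(jordan_dim s)) => //; apply/similarP => //.
rewrite /jordan_mx mxcol_mul mul_mxdiag_mxcol; apply: eq_mxcol => i.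
apply: jordan_block_chain; rewrite zs //; apply: (ann (z i)).
by rewrite mem_nth // sizel.
Qed.

(** Conversely, the block rows of a conjugating matrix are chains. *)
Lemma jordan_form_chain_system n (A : 'M[F]_n) s :
  jordan_form A s -> exists2 S, chain_system A s S & row_full S.
Proof.
case=> pos [e []]; case: _ / e A => A P unitP /(similarP unitP).
pose B (i : 'I_(size s)) : 'M[F]_((nth (0%N, 0) s i).1, _) := submxcol P i.
have PB : P = \mxcol_i B i by rewrite submxcolK.
rewrite castmx_id {1 2}PB /jordan_mx mxcol_mul mul_mxdiag_mxcol.
move=> /eq_mxcolP PA.
have posi (i : 'I_(size s)) : (0 < (nth (0%N, 0%R) s i).1)%N.
  by have /allP := pos; apply; rewrite mem_nth.
pose w i := row (Ordinal (posi i)) (B i).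
pose z (i : 'I_(size s)) : nat * F * 'rV[F]_(jordan_dim s) :=
  (nth (0%N, 0) s i, w i).
have Bz i : chain_vec A (z i) (z i).1.1 = 0 /\
            forall j : 'I_(z i).1.1, row j (B i) = chain_vec A (z i) j.
  apply: jordan_block_chainV (posi i) (PA i) => j j0; congr row; exact: val_inj.
exists (chain_span A (map z (enum 'I_(size s)))).
  exists (map z (enum 'I_(size s))); split=> //.
    rewrite -map_comp -[RHS](mkseq_nth (0%N, 0)) /mkseq -val_enum_ord -map_comp.
    exact: eq_map.
  by move=> y /mapP[i _ ->]; case: (Bz i).
rewrite -sub1mx; apply: submx_trans (_ : P <= _)%MS.
  by rewrite sub1mx row_full_unit.
rewrite PB eqmx_col; apply/sumsmx_subP=> i _; rewrite genmxE.
apply/row_subP=> j; have [_ ->] := Bz i.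
by apply: chain_vec_span => //; rewrite map_f ?mem_enum.
Qed.

End JordanChains.

(** * Chains for a sum of two commuting nilpotents *)

Lemma sizes_bothE m n :
  sizes_both m n =
  [seq (m + n + 1 - 2 * minn m n + 2 * i)%N | i <- iota 0 (minn m n)].
Proof. by rewrite /sizes_both /steps2; congr map; congr iota; lia. Qed.

(** The recursion on sizes that matches the Clebsch-Gordan induction. *)
Lemma sizes_bothSS m n :
  sizes_both m.+1 n.+1 = sizes_both m n ++ [:: (m + n + 1)%N].
Proof.
rewrite !sizes_bothE minnSS -[(minn m n).+1]addn1 iotaD map_cat /=.
by congr (_ ++ [:: _]); [apply: eq_map => i | ]; lia.
Qed.

(** The lists of the second and third cases are concatenations of lists of the
    first case, one for each layer of a cyclic module. *)
Lemma sizes_oneE m n r :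
  sizes_one m n r =
  flatten (nseq (r - n %% r) (sizes_both m (n %/ r))) ++
  flatten (nseq (n %% r) (sizes_both m (n %/ r).+1)).
Proof.
rewrite /sizes_one /=; move: (n %/ r)%N => a; congr (_ ++ flatten (nseq _ _)).
by rewrite /sizes_both; congr steps2; lia.
Qed.

Lemma size_sizes_both m n : size (sizes_both m n) = minn m n.
Proof. by rewrite sizes_bothE size_map size_iota. Qed.

Lemma size_sizes_one m n r : size (sizes_one m n r) = count_one m n r.
Proof.
rewrite sizes_oneE size_cat !size_flatten /shape !map_nseq !sumn_nseq.
by rewrite !size_sizes_both mulnC [X in (_ + X)%N]mulnC.
Qed.

Lemma sumn_sizes_both m n : sumn (sizes_both m n) = (m * n)%N.
Proof.
elim: m n => [|m IH] [|n]; rewrite ?sizes_bothE ?minn0 ?min0n ?muln0 //.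
by rewrite -sizes_bothE sizes_bothSS sumn_cat IH /=; lia.
Qed.

Lemma sumn_sizes_one m n r : (0 < r)%N -> sumn (sizes_one m n r) = (m * n)%N.
Proof.
move=> r0; rewrite sizes_oneE sumn_cat !sumn_flatten !map_nseq !sumn_nseq.
rewrite !sumn_sizes_both.
move: (divn_eq n r) (ltn_pmod n r0); move: (n %% r)%N (n %/ r)%N => b a -> ltb.
have [d ->] : exists d, r = (d + b)%N by exists (r - b)%N; lia.
by rewrite addnK; ring.
Qed.

Lemma all_gt0_sizes_both m n : all (leq 1) (sizes_both m n).
Proof. by rewrite sizes_bothE; apply/allP=> _ /mapP[i _ ->] /=; lia. Qed.

Lemma all_gt0_sizes_one m n r : all (leq 1) (sizes_one m n r).
Proof.
rewrite sizes_oneE all_cat; apply/andP.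
by split; apply/allP=> x /flattenP[t /nseqP[-> _]];
  apply/allP/all_gt0_sizes_both.
Qed.

Lemma sizes_one_r1 m n : sizes_one m n 1 = sizes_both m n.
Proof. by rewrite sizes_oneE modn1 divn1 /= !cats0. Qed.

Section ClebschGordan.
Variables (F : fieldType) (charF0 : [pchar F] =i pred0).

Lemma submx_scaleK n (a : F) (v : 'rV[F]_n) (S : 'M[F]_n) :
  a != 0 -> (a *: v <= S)%MS -> (v <= S)%MS.
Proof. by move=> a0; rewrite eqmx_scale. Qed.

(** Z a b stands for the divided power monomial
    s^(a-1) t^(b-1) / ((a-1)! (b-1)!), on which A - c acts as the derivation
    d/ds + d/dt; the indices are shifted so that Z vanishes at a = 0 and b = 0.
    The family Z' below is the multiple of Z by s - t, which the derivation
    kills, so Z' satisfies the same recurrence with smaller bounds.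
    Characteristic zero enters through the coefficient a + b - 1: it is what
    allows Z a b to be recovered from (Z (a+1) b)(A - c) modulo the span of
    Z'. *)
Lemma clebsch_gordan_chains n (A : 'M[F]_n) c k l (Z : nat -> nat -> 'rV[F]_n) :
  (forall b, Z 0%N b = 0) -> (forall a, Z a 0%N = 0) ->
  (forall a b, (a < k)%N -> (b < l)%N ->
     Z a.+1 b.+1 *m (A - c%:M) = Z a b.+1 + Z a.+1 b) ->
  exists2 S, chain_system A [seq (i, c) | i <- sizes_both k l] S &
    forall a b, (a <= k)%N -> (b <= l)%N -> (Z a b <= S)%MS.
Proof.
elim: k l Z => [|k IH] [|l] Z Z0l Z0r ZD; rewrite ?sizes_bothE ?minn0 ?min0n /=.
1-3: exists 0; first exact: chain_system_nil.
- by move=> a b; rewrite leqn0 => /eqP->; rewrite Z0l sub0mx.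
- by move=> a b; rewrite leqn0 => /eqP->; rewrite Z0l sub0mx.
- by move=> a b _; rewrite leqn0 => /eqP->; rewrite Z0r sub0mx.
rewrite -sizes_bothE sizes_bothSS map_cat /=.
pose Z' a b : 'rV[F]_n := a%:R *: Z a.+1 b - b%:R *: Z a b.+1.
have [b|a|a b ltk ltl|S' sysS' subS'] := IH l Z'.
- by rewrite /Z' Z0l scale0r scaler0 subr0.
- by rewrite /Z' Z0r scale0r scaler0 subr0.
- rewrite /Z' mulmxBl -!scalemxAl !ZD ?ltnS ?(ltnW ltk) ?(ltnW ltl) //.
  apply/rowP=> j; rewrite !mxE; ring.
have Zann e a b : (a <= k.+1)%N -> (b <= l.+1)%N -> (a + b <= e.+1)%N ->
    Z a b *m (A - c%:M) ^+ e = 0.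
  elim: e a b => [|e IHe] [|a] [|b] //; rewrite ?Z0l ?Z0r ?mul0mx //.
    by move=> _ _; lia.
  move=> lek lel le; rewrite exprS -mulmxE mulmxA ZD // mulmxDl.
  rewrite !IHe ?addr0 //; lia.
set S := (S' + \sum_(j < k + l + 1) <<Z k.+1 l.+1 *m (A - c%:M) ^+ j>>)%MS.
have sysS : chain_system A
    ([seq (i, c) | i <- sizes_both k l] ++ [:: ((k + l + 1)%N, c)]) S.
  by apply: chain_system_cat sysS' _; apply: chain_system1; apply: Zann; lia.
exists S => // -[|a] [|b] lek lel; rewrite ?Z0l ?Z0r ?sub0mx //.
have Z'S i j : (i <= k)%N -> (j <= l)%N -> (Z' i j <= S)%MS.
  by move=> lei lej; apply: submx_trans (subS' i j lei lej) (addsmxSl _ _).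
have SD (v : 'rV_n) : (v <= S -> v *m (A - c%:M) <= S)%MS.
  by move=> vS; apply: submx_trans (submxMr _ vS) (chain_system_stable c sysS).
have nz i : i.+1%:R != 0 :> F by rewrite (pcharf0P _).1.
(* Induction on the distance e of (a, b) from the top corner (k, l), whose
   vector generates the new chain. *)
have [e le_e] : exists e, ((k - a) + (l - b) <= e)%N.
  by exists ((k - a) + (l - b))%N.
elim: e a b le_e lek lel => [|e IHe] a b le_e lek lel.
  have -> : a = k by lia.
  have -> : b = l by lia.
  apply: submx_trans (addsmxSr _ _).
  have lt0 : (0 < k + l + 1)%N by lia.
  by apply: (sumsmx_sup (Ordinal lt0)); rewrite //= genmxE expr0 mulmx1.
case: (ltnP a k) => [ltk|lek'].
  have /SD : (Z a.+2 b.+1 <= S)%MS by apply: IHe; lia.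
  rewrite ZD // => /(scalemx_sub a.+1%:R) inS; have := Z'S a.+1 b ltk lel.
  rewrite -(eqmx_opp (Z' _ _)) => /(addmx_sub inS) in2.
  (* (a+1)(Z (a+1) (b+1) + Z (a+2) b) - Z' (a+1) b = (a+b+1) Z (a+1) (b+1) *)
  apply: (@submx_scaleK _ (a + b)%N.+1%:R) => //; apply: etrans in2;
  congr submx; rewrite /Z'; apply/rowP=> j; rewrite !mxE; ring.
case: (ltnP b l) => [ltl|lel']; last by apply: IHe; lia.
have /SD : (Z a.+1 b.+2 <= S)%MS by apply: IHe; lia.
rewrite ZD // => /(scalemx_sub b.+1%:R) inS; have := Z'S a b.+1 lek ltl.
move=> /(addmx_sub inS) in2.
(* (b+1)(Z a (b+2) + Z (a+1) (b+1)) + Z' a (b+1) = (a+b+1) Z (a+1) (b+1) *)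
apply: (@submx_scaleK _ (a + b)%N.+1%:R) => //; apply: etrans in2;
congr submx; rewrite /Z'; apply/rowP=> j; rewrite !mxE; ring.
Qed.

End ClebschGordan.

(** * Cyclic modules over a commutative ring *)

(** R acts on row vectors through phi, and e is a residue map for the point
    where x and y vanish.  The conditions on x and y concern only the vector w,
    hence the cyclic module that it generates. *)
Section CyclicModule.
Variables (F : fieldType) (charF0 : [pchar F] =i pred0).
Variables (R : comNzRingType) (d : nat).
Variables (phi : {rmorphism R -> 'M[F]_d.+1}) (e : {rmorphism R -> F}).
Variables (x y u v : R) (c : F) (w : 'rV[F]_d.+1) (m n r : nat).
Hypothesis phi_local :
  forall f, exists f1 f2, phi f = (e f)%:M + phi (x * f1 + y * f2).
Hypothesis annx : w *m phi (x ^+ m) = 0.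
Hypothesis anny : w *m phi (y ^+ n) = 0.
Hypothesis r_gt0 : (0 < r)%N.
Hypothesis eu : e u != 0.
Hypothesis ev : e v != 0 \/ (n <= r)%N.
Let A := c%:M + phi (x * u + y ^+ r * v).

Lemma cyclic_annx a f : (m <= a)%N -> w *m phi (x ^+ a * f) = 0.
Proof.
by move=> /subnKC <-; rewrite exprD -mulrA rmorphM -mulmxE mulmxA annx mul0mx.
Qed.

Lemma cyclic_anny b f : (n <= b)%N -> w *m phi (y ^+ b * f) = 0.
Proof.
by move=> /subnKC <-; rewrite exprD -mulrA rmorphM -mulmxE mulmxA anny mul0mx.
Qed.

(** The layer y^i of the cyclic module, in the coordinates x' = x u and
    y' = y^r v whose sum is A - c. *)
Definition cyclic_vec i a b :=
  w *m phi (y ^+ i * (x * u) ^+ a * (y ^+ r * v) ^+ b).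

(** On one layer x'^m and y'^l act as zero, so the Clebsch-Gordan recurrence
    holds for Z a b = w y^i x'^(m-a) y'^(l-b). *)
Lemma cyclic_layer i l : (n <= i + r * l)%N ->
  exists2 S, chain_system A [seq (k, c) | k <- sizes_both m l] S &
    forall a b, (cyclic_vec i a b <= S)%MS.
Proof.
move=> le_n.
have ann_a a b : (m <= a)%N -> cyclic_vec i a b = 0.
  move=> le; rewrite /cyclic_vec exprMn.
  rewrite (_ : y ^+ i * _ * _ = x ^+ a * (y ^+ i * u ^+ a * (y ^+ r * v) ^+ b));
    last by ring.
  exact: cyclic_annx.
have ann_b a b : (l <= b)%N -> cyclic_vec i a b = 0.
  move=> le; rewrite /cyclic_vec [(y ^+ r * v) ^+ b]exprMn -exprM.
  have -> : y ^+ i * (x * u) ^+ a * (y ^+ (r * b) * v ^+ b) =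
            y ^+ (i + r * b) * ((x * u) ^+ a * v ^+ b).
    by rewrite exprD; ring.
  apply/cyclic_anny/(leq_trans le_n).
  by rewrite leq_add2l leq_mul2l le orbT.
have [b|a|a b lta ltb|S sysS subS] :=
  @clebsch_gordan_chains F charF0 _ A c m l
    (fun a b => cyclic_vec i (m - a) (l - b)).
- by rewrite ann_a ?subn0.
- by rewrite ann_b ?subn0.
- have -> : A - c%:M = phi (x * u + y ^+ r * v) by rewrite /A addrC addKr.
  rewrite -(subnSK lta) -(subnSK ltb) /cyclic_vec -mulmxA.
  rewrite mulmxE -rmorphM -mulmxDr -rmorphD !exprS; congr (_ *m phi _); ring.
exists S => // a b; case: (leqP m a) => [/ann_a->|lta]; first exact: sub0mx.
case: (leqP l b) => [/ann_b->|ltb]; first exact: sub0mx.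
have := subS (m - a)%N (l - b)%N (leq_subr _ _) (leq_subr _ _).
by rewrite !subKn // ltnW.
Qed.

Lemma cyclic_layers j k l :
  (forall i, (j <= i < j + k)%N -> (n <= i + r * l)%N) ->
  exists2 S,
    chain_system A [seq (h, c) | h <- flatten (nseq k (sizes_both m l))] S &
    forall i a b, (j <= i < j + k)%N -> (cyclic_vec i a b <= S)%MS.
Proof.
move=> le_n.
have -> : [seq (h, c) | h <- flatten (nseq k (sizes_both m l))] =
          flatten [seq [seq (h, c) | h <- sizes_both m l] | _ <- iota j k].
  by elim: k j {le_n} => //= k IH j; rewrite map_cat (IH j.+1).
have [i|S sysS subS] := @chain_system_flatten _ _ A nat (iota j k)
  (fun=> [seq (h, c) | h <- sizes_both m l])
  (fun i z => exists a b, z = cyclic_vec i a b).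
  rewrite mem_iota => /le_n/cyclic_layer[S sysS subS]; exists S => //.
  by move=> _ [a [b ->]].
by exists S => // i a b lti; apply: (subS i); [rewrite mem_iota | exists a, b].
Qed.

(** The layers with i < n %% r have one more power of y' than the others.  They
    span because passing from x, y to x', y' is triangular for the degree in
    (x, y): the diagonal coefficients are e(u)^k e(v)^(q %/ r), which do not
    vanish; when n <= r, only the exponent q %/ r = 0 occurs. *)
Lemma cyclic_chains :
  exists2 S, chain_system A [seq (k, c) | k <- sizes_one m n r] S &
    forall f, (w *m phi f <= S)%MS.
Proof.
have ltb := ltn_pmod n r_gt0; have dn := divn_eq n r.
have [i|S1 sys1 sub1] := @cyclic_layers (n %% r) (r - n %% r) (n %/ r).
  by move=> /andP[lei _]; rewrite {1}dn addnC mulnC leq_add2r.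
have [i|S2 sys2 sub2] := @cyclic_layers 0 (n %% r) (n %/ r).+1.
  by move=> _; rewrite {1}dn mulnS mulnC; lia.
exists (S1 + S2)%MS.
  by rewrite sizes_oneE map_cat; apply: chain_system_cat.
set S := (S1 + S2)%MS.
have subS i a b : (i < r)%N -> (cyclic_vec i a b <= S)%MS.
  move=> lti; case: (ltnP i (n %% r)) => [ltib|leib].
    by apply: submx_trans (addsmxSr _ _); apply: sub2.
  by apply: submx_trans (addsmxSl _ _); apply: sub1; rewrite leib /=; lia.
(* Descending induction on the degree k + q: from m + n on, the vectors are
   zero. *)
suff down D k q f : (m + n <= k + q + D)%N ->
    (w *m phi (x ^+ k * y ^+ q * f)%R <= S)%MS.
  move=> f; have := down (m + n)%N 0%N 0%N f (leqnn _).
  by rewrite !expr0 !mul1r.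
elim: D k q f => [|D IH] k q f le.
  case: (leqP m k) => [lemk|ltkm]; first by rewrite -mulrA cyclic_annx ?sub0mx.
  rewrite -mulrA mulrCA cyclic_anny ?sub0mx //; lia.
case: (leqP n q) => [lenq|ltqn].
  by rewrite -mulrA mulrCA cyclic_anny ?sub0mx.
have higher f1 f2 : (w *m phi (x ^+ k * y ^+ q * (x * f1 + y * f2))%R <= S)%MS.
  have -> : x ^+ k * y ^+ q * (x * f1 + y * f2) =
            x ^+ k.+1 * y ^+ q * f1 + x ^+ k * y ^+ q.+1 * f2.
    by rewrite !exprS; ring.
  by rewrite rmorphD mulmxDr addmx_sub ?IH //; lia.
have expand g : exists h, w *m phi (x ^+ k * y ^+ q * g) =
    e g *: (w *m phi (x ^+ k * y ^+ q)) + h /\ (h <= S)%MS.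
  have [f1 [f2 eg]] := phi_local g.
  exists (w *m phi (x ^+ k * y ^+ q * (x * f1 + y * f2))); split=> //.
  rewrite !(rmorphM phi (x ^+ k * y ^+ q)) eg -!mulmxE mulmxDr mulmxDr.
  by rewrite mul_mx_scalar -scalemxAr.
have [h [-> hS]] := expand f; apply: addmx_sub hS; apply: scalemx_sub.
(* The element of the layer q %% r with leading term x^k y^q. *)
have [h' [eg h'S]] := expand (u ^+ k * v ^+ (q %/ r)).
have : (cyclic_vec (q %% r) k (q %/ r) <= S)%MS by apply: subS; rewrite ltn_mod.
have -> : cyclic_vec (q %% r) k (q %/ r) =
    w *m phi (x ^+ k * y ^+ q * (u ^+ k * v ^+ (q %/ r))).
  rewrite /cyclic_vec {3}(divn_eq q r) !exprMn -exprM exprD mulnC.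
  by congr (_ *m phi _); ring.
rewrite eg => inS.
have : (- h' <= S)%MS by rewrite eqmx_opp.
move/(addmx_sub inS); rewrite addrK.
apply: submx_scaleK; rewrite rmorphM !rmorphXn mulf_neq0 ?(expf_neq0 k) //.
case: ev => [|le_nr]; first exact: expf_neq0.
by rewrite divn_small ?expr0 ?oner_eq0 // (leq_trans ltqn).
Qed.

End CyclicModule.

(** * Local expansion of a bivariate polynomial *)

Section LocalExpansion.
Variable F : fieldType.
Implicit Types (p u v : {poly {poly F}}) (lam mu : F).

Lemma first_nonzeroP (f : nat -> F) n : (0 < n)%N ->
  [/\ (0 < first_nonzero f n)%N,
      forall k, (0 < k < first_nonzero f n)%N -> f k = 0
    & f (first_nonzero f n) != 0 \/ (n <= first_nonzero f n)%N].
Proof.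
rewrite /first_nonzero.
(* Scan the candidates j, ..., n - 1, given that f vanishes from 1 to j - 1. *)
suff gen j l : (0 < j)%N -> (j + l = n)%N ->
    (forall k, (0 < k < j)%N -> f k = 0) ->
    let r := head n [seq k <- iota j l | f k != 0] in
    [/\ (0 < r)%N, forall k, (0 < k < r)%N -> f k = 0 & f r != 0 \/ (n <= r)%N].
  by move=> n0; apply: gen => //; lia.
elim: l j => [|l IH] j j0 jl zero /=.
  by rewrite -jl addn0; split; [| |right].
case: (eqVneq (f j) 0) => [fj|fj] /=; last by split; [| |left].
apply: IH => //; first by rewrite addSnnS.
move=> k /andP[k0]; rewrite ltnS leq_eqVlt => /predU1P[->//|ltk].
by rewrite zero ?k0.
Qed.

Lemma first_nonzero_gt0 (f : nat -> F) n :
  (0 < n)%N -> (0 < first_nonzero f n)%N.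
Proof. by move=> /(first_nonzeroP f)[]. Qed.

Lemma first_nonzero1 (f : nat -> F) n :
  (0 < n)%N -> f 1%N != 0 -> first_nonzero f n = 1%N.
Proof.
move=> n0 f1; have [r0 zero _] := first_nonzeroP f n0.
apply/eqP; rewrite eqn_leq r0 andbT leqNgt; apply/negP => lt.
by rewrite zero ?eqxx // in f1.
Qed.

Lemma eq_first_nonzero (f g : nat -> F) n :
  f =1 g -> first_nonzero f n = first_nonzero g n.
Proof.
move=> fg; rewrite /first_nonzero; congr head.
by apply: eq_filter => k; rewrite fg.
Qed.

(** Taylor's formula at mu, with the powers from r on collected in v. *)
Lemma taylor_truncated (s : {poly F}) mu r : (0 < r)%N ->
  (forall k, (0 < k < r)%N -> s^`N(k).[mu] = 0) ->
  exists2 v, s = s.[mu]%:P + ('X - mu%:P) ^+ r * v & v.[mu] = s^`N(r).[mu].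
Proof.
move=> r0 zero; pose h : {poly F} := 'X - mu%:P.
have sE : s = \sum_(i < r + (size s).+1) s^`N(i).[mu] *: h ^+ i.
  have sz : (size (map_poly polyC s) <= r + (size s).+1)%N.
    by apply: leq_trans (size_poly _ _) _; lia.
  have := nderiv_taylor_wide (mulrC mu%:P h) sz.
  rewrite addrC subrK -[LHS]/(s \Po 'X) comp_polyXr => {1}->.
  by apply: eq_bigr => i _; rewrite nderivn_map horner_map mul_polyC.
exists (\sum_(i < (size s).+1) s^`N(r + i).[mu] *: h ^+ i); last first.
  rewrite big_ord_recl addn0 hornerD hornerZ expr0 hornerC mulr1.
  rewrite horner_sum big1 ?addr0 // => i _.
  by rewrite hornerZ exprS hornerM /h hornerXsubC subrr mul0r mulr0.
rewrite {1}sE big_split_ord /=; congr (_ + _).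
  case: r r0 zero {sE} => // r _ zero; rewrite big_ord_recl nderivn0 expr0.
  rewrite big1 ?addr0 ?alg_polyC // => i _.
  by rewrite lift0 zero ?scale0r //= ltnS.
by rewrite mulr_sumr; apply: eq_bigr => i _; rewrite -scalerAr exprD.
Qed.

Lemma hasse0_eval k p lam mu : (hasse 0 k p).[lam, mu] = p.[lam%:P]^`N(k).[mu].
Proof.
congr (_.[mu]); rewrite /hasse nderivn0.
rewrite (horner_coef_wide _ (size_poly _ _)) horner_coef raddf_sum.
apply: eq_bigr => i _ /=; rewrite coef_map_id0 ?raddf0 //.
by rewrite -polyC_exp ![_ * _%:P]mulrC !mul_polyC nderivnZ.
Qed.

(** Dividing p by X - lam leaves a remainder in y alone, namely p(lam, y), whose
    Taylor expansion at mu starts in degree r after the constant term. *)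
Lemma local_expansion p lam mu n : (0 < n)%N ->
  let r := first_nonzero (fun k => (hasse 0 k p).[lam, mu]) n in
  exists u v, [/\ (0 < r)%N,
    p = p.[lam, mu]%:P%:P + (('X - lam%:P%:P) * u + ('Y - mu%:P%:P) ^+ r * v),
    u.[lam, mu] = (hasse 1 0 p).[lam, mu] & v.[lam, mu] != 0 \/ (n <= r)%N].
Proof.
move=> n0 r.
have [r0 zero last_nz] := first_nonzeroP (fun k => (hasse 0 k p).[lam, mu]) n0.
rewrite -/r in r0 zero last_nz.
have [|v pv vr] := @taylor_truncated p.[lam%:P] mu r r0.
  by move=> k /zero; rewrite hasse0_eval.
have /factor_theorem[u pu] : root (p - p.[lam%:P]%:P) lam%:P.
  by rewrite /root hornerD hornerN hornerC subrr.
have cE : p.[lam%:P]%:P = p.[lam, mu]%:P%:P + ('Y - mu%:P%:P) ^+ r * v%:P.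
  by rewrite {1}pv rmorphD rmorphM rmorphXn rmorphB.
have pE : p = p.[lam, mu]%:P%:P +
    (('X - lam%:P%:P) * u + ('Y - mu%:P%:P) ^+ r * v%:P).
  by rewrite -[LHS](subrK p.[lam%:P]%:P) pu cE mulrC addrCA.
exists u, v%:P; split=> //; last by rewrite hornerC vr -hasse0_eval.
rewrite /hasse nderivn1.
have -> : map_poly (nderivn 0) p^`() = p^`().
  by apply/polyP=> i; rewrite coef_map_id0 ?raddf0 // nderivn0.
have /(congr1 (fun q => q^`().[lam, mu])) := pu.
rewrite derivB derivC subr0 derivM derivXsubC mulr1 => ->.
by rewrite hornerD hornerM hornerXsubC subrr mulr0 add0r.
Qed.

Lemma coef_hasse al be p i j :
  (hasse al be p)`_i`_j =
  p`_(al + i)`_(be + j) *+ 'C(al + i, al) *+ 'C(be + j, be).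
Proof.
rewrite /hasse coef_map_id0 ?raddf0 // !coef_nderivn.
by rewrite coefMn mulrnAC.
Qed.

Lemma hasse_swapXY al be p : hasse al be (swapXY p) = swapXY (hasse be al p).
Proof.
apply/polyP=> i; apply/polyP=> j.
by rewrite coef_swapXY !coef_hasse coef_swapXY mulrnAC.
Qed.

(** If p_x and p_y are both nonzero, then [order_y] is 1 and the first case
    reduces to the second. *)
Lemma pair_sizesE p m n lam mu : (0 < n)%N ->
  (px p (m, lam) (n, mu), py p (m, lam) (n, mu)) <> (0, 0) ->
  pair_sizes p (m, lam) (n, mu) =
  if px p (m, lam) (n, mu) != 0
  then sizes_one m n (order_y p (m, lam) (n, mu))
  else sizes_one n m (order_x p (m, lam) (n, mu)).
Proof.
move=> n0 nondeg; rewrite /pair_sizes /case_both /case_x /case_y /=.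
case: (eqVneq (px _ _ _) 0) nondeg => [->|nzx] nondeg /=.
  case: (eqVneq (py _ _ _) 0) nondeg => [->|nzy] nondeg //=.
  by rewrite orbT.
case: (eqVneq (py _ _ _) 0) => [_|nzy] /=; first by rewrite orbT.
by rewrite /order_y first_nonzero1 // sizes_one_r1.
Qed.

End LocalExpansion.

Section PairOfBlocks.
Variables (F : fieldType) (charF0 : [pchar F] =i pred0) (d : nat).
Variables (phi : {rmorphism {poly {poly F}} -> 'M[F]_d.+1}).
Hypothesis phiC : forall c, phi c%:P%:P = c%:M.

(** Evaluation at (lam, mu) is the residue map required for the cyclic module:
    the case n = 1 of the local expansion. *)
Lemma eval_local (lam mu : F) f : exists f1 f2,
  phi f = f.[lam, mu]%:M +
          phi (('X - lam%:P%:P) * f1 + ('Y - mu%:P%:P) * f2).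
Proof.
have [u [v [_ fE _ _]]] := local_expansion f lam mu (ltn0Sn 0).
by exists u, v; rewrite {1}fE rmorphD phiC.
Qed.

(** When p_x = 0 the roles of x and y are exchanged by expanding [swapXY p] and
    swapping back. *)
Lemma pair_chains p (w : 'rV[F]_d.+1) m n lam mu :
  (0 < m)%N -> (0 < n)%N ->
  w *m phi (('X - lam%:P%:P) ^+ m) = 0 -> w *m phi (('Y - mu%:P%:P) ^+ n) = 0 ->
  (px p (m, lam) (n, mu), py p (m, lam) (n, mu)) <> (0, 0) ->
  exists2 S, chain_system (phi p) (pair_blocks p (m, lam) (n, mu)) S &
    forall f, (w *m phi f <= S)%MS.
Proof.
move=> m0 n0 annx anny nondeg; rewrite /pair_blocks pair_sizesE //=.
pose e : {rmorphism {poly {poly F}} -> F} :=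
  horner_eval mu \o horner_eval lam%:P.
case: eqP => [px0|/eqP px0] /=.
  have [v [u [r0 pE vE last_nz]]] := local_expansion (swapXY p) mu lam m0.
  have ordE : first_nonzero (fun k => (hasse 0 k (swapXY p)).[mu, lam]) m =
              order_x p (m, lam) (n, mu).
    by apply: eq_first_nonzero => k; rewrite hasse_swapXY horner2_swapXY.
  rewrite ordE in r0 pE last_nz; rewrite horner2_swapXY in pE.
  have {pE} pE : p = p.[lam, mu]%:P%:P +
      (('Y - mu%:P%:P) * swapXY v +
       ('X - lam%:P%:P) ^+ (order_x p (m, lam) (n, mu)) * swapXY u).
    have /(congr1 (@swapXY F)) := pE; rewrite swapXYK => {1}->.
    rewrite rmorphD rmorphD !rmorphM rmorphXn !rmorphB /=.
    by rewrite swapXY_X swapXY_Y !swapXY_polyC !map_polyC.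
  rewrite {1}pE rmorphD phiC.
  apply: (@cyclic_chains F charF0 _ _ phi e) => //.
  - move=> f; have [f1 [f2 ->]] := eval_local lam mu f.
    by exists f2, f1; rewrite [_ * f2 + _]addrC.
  - rewrite /e /= /horner_eval horner2_swapXY vE hasse_swapXY horner2_swapXY.
    by apply/eqP => py0; apply: nondeg; rewrite px0 -py0.
  - by rewrite /e /= /horner_eval horner2_swapXY.
have [u [v [r0 pE uE last_nz]]] := local_expansion p lam mu n0.
rewrite {1}pE rmorphD phiC.
apply: (@cyclic_chains F charF0 _ _ phi e) => //.
- exact: eval_local.
- by rewrite /e /= /horner_eval uE.
Qed.

End PairOfBlocks.

(** * Kronecker products of chains *)

Section KroneckerEvaluation.
Variable F : fieldType.

Lemma chain_system_exists n (A : 'M[F]_n) s : exists S, chain_system A s S.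
Proof.
pose l : seq (nat * F * 'rV[F]_n) := [seq (u, 0) | u <- s].
exists (chain_span A l), l; split=> //; first by rewrite -map_comp map_id.
by move=> _ /mapP[u _ ->]; rewrite /chain_vec mul0mx.
Qed.

(** Substituting commuting matrices for the two variables, as a ring morphism
    out of the iterated polynomial ring. *)
Lemma bivariate_eval d (A B : 'M[F]_d.+1) : A *m B = B *m A ->
  exists phi : {rmorphism {poly {poly F}} -> 'M[F]_d.+1},
    [/\ forall c, phi c%:P%:P = c%:M, phi 'X = A & phi 'Y = B].
Proof.
move=> AB; have cAB : commr_rmorph (horner_mx B) A.
  by move=> q; apply/comm_mx_horner.
exists (horner_morph cAB); split=> [c||]; last 2 first.
- exact: horner_morphX.
- by rewrite /= horner_morphC /= horner_mx_X.
- by rewrite /= horner_morphC /= horner_mx_C.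
Qed.

Lemma tensmxDl m n p q (A A' : 'M[F]_(m, n)) (B : 'M[F]_(p, q)) a :
  (a *: A + A') *t B = a *: (A *t B) + A' *t B.
Proof. by apply/matrixP=> i j; rewrite !mxE mulrDl mulrA. Qed.

Lemma tensmxDr m n p q (A : 'M[F]_(m, n)) (B B' : 'M[F]_(p, q)) a :
  A *t (a *: B + B') = a *: (A *t B) + A *t B'.
Proof. by apply/matrixP=> i j; rewrite !mxE mulrDr mulrCA. Qed.

Lemma tens_scalar_scalar M N (a b : F) :
  (a%:M : 'M_M) *t (b%:M : 'M_N) = (a * b)%:M.
Proof.
apply/matrixP=> i j.
case: (mxtens_indexP i) => i1 i2; case: (mxtens_indexP j) => j1 j2.
rewrite tensmxE !mxE (can_eq (@mxtens_indexK M N)) xpair_eqE.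
by case: eqP; case: eqP; rewrite ?mulr0 ?mul0r.
Qed.

Lemma tens_expl M N (A : 'M[F]_M) k :
  (A *t (1%:M : 'M_N)) ^+ k = A ^+ k *t 1%:M.
Proof.
elim: k => [|k IH]; first by rewrite !expr0 [RHS]tens_scalar_scalar mulr1.
by rewrite !exprS IH -mulmxE tensmx_mul mulmx1.
Qed.

Lemma tens_expr M N (B : 'M[F]_N) k :
  ((1%:M : 'M_M) *t B) ^+ k = 1%:M *t B ^+ k.
Proof.
elim: k => [|k IH]; first by rewrite !expr0 [RHS]tens_scalar_scalar mulr1.
by rewrite !exprS IH -mulmxE tensmx_mul mulmx1.
Qed.

(** Preimages of subspaces under linear maps, used to extend an inclusion from
    chain vectors to all vectors in one Kronecker factor at a time. *)
Lemma linear_preimage m n (f : 'rV[F]_m -> 'rV[F]_n) (S : 'M[F]_n) :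
  (forall a u v, f (a *: u + v) = a *: f u + f v) ->
  exists V : 'M[F]_m, forall g, (g <= V)%MS = (f g <= S)%MS.
Proof.
move=> lin; pose fL : {linear 'rV[F]_m -> 'rV[F]_n} :=
  HB.pack f (GRing.isLinear.Build _ _ _ _ f lin).
exists (kermx (lin1_mx fL *m cokermx S)) => g; rewrite (submxE _ S).
by apply/sub_kermxP/eqP; rewrite mulmxA mul_rV_lin1.
Qed.

Lemma jordan_dimE s : jordan_dim (F := F) s = (\sum_(u <- s) u.1)%N.
Proof. by rewrite (big_nth (0%N, 0)) big_mkord. Qed.

End KroneckerEvaluation.

Section KroneckerChains.
Variables (F : fieldType) (charF0 : [pchar F] =i pred0).
Variables (K : nat) (a : nat -> nat -> F).
Let p := bipoly K a.

Lemma kron_eval_phi M N (X : 'M[F]_M.+1) (Y : 'M[F]_N.+1)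
  (phi : {rmorphism {poly {poly F}} -> 'M[F]_((N + M * N.+1).+1)}) :
  (forall c, phi c%:P%:P = c%:M) -> phi 'X = X *t (1%:M : 'M_N.+1) ->
  phi 'Y = (1%:M : 'M_M.+1) *t Y ->
  phi p = kron_eval K a X Y.
Proof.
move=> phiC phiX phiY; rewrite /p /bipoly rmorph_sum; apply: eq_bigr => i _.
rewrite rmorph_sum; apply: eq_bigr => j _.
have eX : phi 'X ^+ i = X ^+ i *t (1%:M : 'M_N.+1).
  rewrite phiX; exact (tens_expl N.+1 X i).
have eY : phi 'Y ^+ j = (1%:M : 'M_M.+1) *t Y ^+ j.
  rewrite phiY; exact (tens_expr M.+1 Y j).
have eXY : (X ^+ i *t 1%:M) *m (1%:M *t Y ^+ j) = X ^+ i *t Y ^+ j.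
  by rewrite tensmx_mul mulmx1 mul1mx.
rewrite !rmorphM !rmorphXn /= eX eY phiC -!mulmxE mul_scalar_mx.
congr (_ *: _); exact eXY.
Qed.

(** If M or N is zero then all the vectors vanish, and chains generated by zero
    vectors have the required sizes.  Otherwise M * N is a successor by
    computation, which the ring of square matrices needs. *)
Lemma kron_pair_chains M N (X : 'M[F]_M) (Y : 'M[F]_N)
    (g : 'rV[F]_M) (h : 'rV[F]_N) m n lam mu :
  (0 < m)%N -> (0 < n)%N ->
  g *m (X - lam%:M) ^+ m = 0 -> h *m (Y - mu%:M) ^+ n = 0 ->
  (px p (m, lam) (n, mu), py p (m, lam) (n, mu)) <> (0, 0) ->
  exists2 S,
    chain_system (kron_eval K a X Y) (pair_blocks p (m, lam) (n, mu)) S &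
    forall i j, ((g *m (X - lam%:M) ^+ i) *t (h *m (Y - mu%:M) ^+ j) <= S)%MS.
Proof.
case: M X g => [|M] X g m0 n0 annX annY nondeg.
  have [S sysS] :=
    chain_system_exists (kron_eval K a X Y) (pair_blocks p (m, lam) (n, mu)).
  by exists S => // i j; rewrite [g *m _]thinmx0 tens0mx sub0mx.
case: N Y h annY => [|N] Y h annY.
  have [S sysS] :=
    chain_system_exists (kron_eval K a X Y) (pair_blocks p (m, lam) (n, mu)).
  by exists S => // i j; rewrite [h *m _]thinmx0 tensmx0 sub0mx.
have [|phi [phiC phiX phiY]] := @bivariate_eval F (N + M * N.+1)
    (X *t (1%:M : 'M_N.+1)) ((1%:M : 'M_M.+1) *t Y).
  have := tensmx_mul X 1%:M 1%:M Y; rewrite mulmx1 mul1mx => XY.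
  have := tensmx_mul 1%:M Y X 1%:M; rewrite mulmx1 mul1mx => YX.
  exact (etrans XY (esym YX)).
have phiXl i :
    phi (('X - lam%:P%:P) ^+ i) = (X - lam%:M) ^+ i *t (1%:M : 'M_N.+1).
  have -> : phi (('X - lam%:P%:P) ^+ i) =
            ((X - lam%:M) *t (1%:M : 'M_N.+1) : 'M_((N + M * N.+1).+1)) ^+ i.
    rewrite rmorphXn rmorphB /= phiC phiX; congr (_ ^+ i).
    have -> : lam%:M = (lam%:M : 'M_M.+1) *t (1%:M : 'M_N.+1)
              :> 'M_((N + M * N.+1).+1).
      by rewrite [RHS]tens_scalar_scalar mulr1.
    by apply/matrixP=> k l; rewrite !mxE mulrBl.
  exact (tens_expl N.+1 (X - lam%:M) i).
have phiYm j :
    phi (('Y - mu%:P%:P) ^+ j) = (1%:M : 'M_M.+1) *t (Y - mu%:M) ^+ j.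
  have -> : phi (('Y - mu%:P%:P) ^+ j) =
            ((1%:M : 'M_M.+1) *t (Y - mu%:M) : 'M_((N + M * N.+1).+1)) ^+ j.
    rewrite rmorphXn rmorphB /= phiC phiY; congr (_ ^+ j).
    have -> : mu%:M = (1%:M : 'M_M.+1) *t (mu%:M : 'M_N.+1)
              :> 'M_((N + M * N.+1).+1).
      by rewrite [RHS]tens_scalar_scalar mul1r.
    by apply/matrixP=> k l; rewrite !mxE mulrBr.
  exact (tens_expr M.+1 (Y - mu%:M) j).
pose w : 'rV[F]_((N + M * N.+1).+1) := g *t h.
have wD (g' : 'rV[F]_M.+1) (h' : 'rV[F]_N.+1)
    (D : 'M[F]_M.+1) (E : 'M[F]_N.+1) :
    (g' *t h' : 'rV_((N + M * N.+1).+1)) *m (D *t E : 'M_((N + M * N.+1).+1)) =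
    (g' *m D) *t (h' *m E).
  exact (tensmx_mul g' h' D E).
have wX : w *m phi (('X - lam%:P%:P) ^+ m) = 0 by rewrite phiXl wD annX tens0mx.
have wY : w *m phi (('Y - mu%:P%:P) ^+ n) = 0 by rewrite phiYm wD annY tensmx0.
have [S sysS subS] := pair_chains charF0 phiC m0 n0 wX wY nondeg.
rewrite (kron_eval_phi phiC phiX phiY) in sysS; exists S => // i j.
have := subS (('X - lam%:P%:P) ^+ i * ('Y - mu%:P%:P) ^+ j).
by rewrite rmorphM phiXl phiYm -mulmxE mulmxA !wD !mulmx1.
Qed.

Lemma pair_blocks_dim u v :
  (0 < u.1)%N -> (0 < v.1)%N ->
  (px p u v, py p u v) <> (0, 0) ->
  (\sum_(b <- pair_blocks p u v) b.1)%N = (u.1 * v.1)%N.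
Proof.
case: u v => [m lam] [n mu] /= m0 n0 nondeg.
rewrite /pair_blocks pair_sizesE // big_map -sumnE.
case: ifP => _; first by rewrite sumn_sizes_one // first_nonzero_gt0.
by rewrite sumn_sizes_one 1?mulnC // first_nonzero_gt0.
Qed.

Lemma pair_blocks_pos u v :
  (0 < v.1)%N -> (px p u v, py p u v) <> (0, 0) ->
  all (fun b => 0 < b.1)%N (pair_blocks p u v).
Proof.
case: u v => [m lam] [n mu] /= n0 nondeg.
rewrite /pair_blocks pair_sizesE // all_map.
by case: ifP => _; apply: all_gt0_sizes_one.
Qed.

Lemma size_pair_blocks (q : {poly {poly F}}) u v :
  size (pair_blocks q u v) = pair_count q u v.
Proof.
rewrite /pair_blocks /pair_count size_map /pair_sizes.
by do ![case: ifP => _]; rewrite ?size_sizes_both ?size_sizes_one.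
Qed.

(** The vectors g (x) h, with g and h taken from chains of X and Y, span the
    whole space because the chains of X and of Y do. *)
Lemma kron_jordan_form M N (X : 'M[F]_M) (Y : 'M[F]_N) (sX sY : seq (nat * F)) :
  jordan_form X sX -> jordan_form Y sY ->
  (forall u v : nat * F, u \in sX -> v \in sY ->
       (px p u v, py p u v) <> (0, 0)) ->
  jordan_form (kron_eval K a X Y) (all_blocks p sX sY).
Proof.
move=> jX jY nondeg.
have [[/allP posX [dimX _]] [/allP posY [dimY _]]] := (jX, jY).
have [_ [lX [lsX annX ->]] fullX] := jordan_form_chain_system jX.
have [_ [lY [lsY annY ->]] fullY] := jordan_form_chain_system jY.
have inX z : z \in lX -> z.1 \in sX by rewrite -lsX; apply: map_f.
have inY z : z \in lY -> z.1 \in sY by rewrite -lsY; apply: map_f.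
pose blocks zz :=
  pair_blocks p (zz : _ * 'rV[F]_M * (_ * 'rV[F]_N)).1.1 zz.2.1.
have [zz|S sysS subS] := @chain_system_flatten F _ (kron_eval K a X Y) _
  [seq (z1, z2) | z1 <- lX, z2 <- lY] blocks
  (fun zz v => exists i j, v = chain_vec X zz.1 i *t chain_vec Y zz.2 j).
  case/allpairsP=> -[[[m lam] g] [[n mu] h]] /= [inl1 inl2 ->].
  have inu := inX _ inl1; have inv := inY _ inl2.
  have [S sysS subS] := kron_pair_chains (posX _ inu) (posY _ inv)
    (annX _ inl1) (annY _ inl2) (nondeg _ _ inu inv).
  by exists S => // _ [i [j ->]]; apply: subS.
apply: (@chain_system_jordan_form F _ _ _ S).
- apply/allP=> b /flattenP[t /allpairsP[[u v] /= [uX vY ->]]].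
  by move: b; apply/allP/pair_blocks_pos; [apply: posY | apply: nondeg].
- rewrite jordan_dimE /all_blocks big_flatten big_allpairs_dep /=.
  rewrite -dimX -dimY !jordan_dimE big_distrlr; apply: eq_big_seq => u uX.
  apply: eq_big_seq => v vY; rewrite pair_blocks_dim //.
  + exact: posX.
  + exact: posY.
  + exact: nondeg.
- move: sysS; rewrite map_allpairs /blocks /all_blocks -lsX -lsY.
  by rewrite allpairs_mapl allpairs_mapr.
rewrite -sub1mx.
(* First g, then h, is allowed to be arbitrary. *)
have subS1 z2 j : z2 \in lY -> forall g : 'rV[F]_M,
    (g *t chain_vec Y z2 j <= S)%MS.
  move=> lz2 g.
  have [V VE] := @linear_preimage F _ _
    (fun g : 'rV[F]_M => g *t chain_vec Y z2 j) S
    (fun a u v => tensmxDl u v (chain_vec Y z2 j) a).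
  rewrite -VE; apply: submx_trans (_ : chain_span X lX <= V)%MS.
    exact: submx_full.
  apply: chain_span_sub => z1 lz1 i _; rewrite VE.
  by apply: (subS (z1, z2)); [apply: allpairs_f | exists i, j].
have subS2 (g : 'rV[F]_M) (h : 'rV[F]_N) : (g *t h <= S)%MS.
  have [V VE] := @linear_preimage F _ _ (fun h : 'rV[F]_N => g *t h) S
    (fun a u v => tensmxDr g u v a).
  rewrite -VE; apply: submx_trans (_ : chain_span Y lY <= V)%MS.
    exact: submx_full.
  by apply: chain_span_sub => z2 lz2 j _; rewrite VE; apply: subS1.
apply/row_subP=> k; case: (mxtens_indexP k) => i j.
have -> : row (mxtens_index (i, j)) 1%:M =
    (delta_mx 0 i : 'rV[F]_M) *t (delta_mx 0 j : 'rV[F]_N) :> 'rV[F]_(M * N).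
  apply/rowP=> l; case: (mxtens_indexP l) => i' j'.
  rewrite !mxE mxtens_indexK /= (can_eq (@mxtens_indexK M N)) xpair_eqE.
  by rewrite -natrM mulnb ![_ == i]eq_sym ![_ == j]eq_sym.
exact: subS2.
Qed.

End KroneckerChains.

Theorem theorem3p1 (F : closedFieldType) (charF0 : [pchar F] =i pred0)
    (K M N : nat) (a : nat -> nat -> F) (X : 'M[F]_M) (Y : 'M[F]_N)
    (sX sY : seq (nat * F))
    (jordanX : jordan_form X sX) (jordanY : jordan_form Y sY)
    (nondeg : forall u v : nat * F, u \in sX -> v \in sY ->
       (px (bipoly K a) u v, py (bipoly K a) u v) <> (0, 0)) :
  jordan_form (kron_eval K a X Y) (all_blocks (bipoly K a) sX sY) /\
  (forall u v : nat * F, u \in sX -> v \in sY ->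
     size (pair_blocks (bipoly K a) u v) = pair_count (bipoly K a) u v).
Proof.
split=> [|u v _ _]; last exact: size_pair_blocks.
exact: kron_jordan_form.
Qed.
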